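(* Let $G$ be a finitely generated torsion-free nilpotent group, $H$ a subgroup of $G$ of finite index $m$, where $m$ is a square-free integer, and $f:H\rightarrow G$ a simple epimorphism. Then $G$ is abelian.
   Context: The homomorphism $f:H\to G$ is simple if the only subgroup $K$ of $H$ which is normal in $G$ and satisfies $K^f\leq K$ (where $K^f$ is the image of $K$ under $f$) is the trivial subgroup. *)

(* Defs.v *)
(* MathComp, with classical sets from MathComp-Analysis. *)
From mathcomp Require Import all_boot.
From mathcomp Require Import boolp classical_sets functions cardinality.

Set Implicit Arguments.
Unset Strict Implicit.
Unset Printing Implicit Defensive.

Local Open Scope classical_set_scope.
Local Open Scope card_scope.
Local Open Scope group_scope.

Definition subgroup (G : groupType) (H : set G) : Prop :=
  group_closed (mem H).

Definition normal_subset (G : groupType) (K : set G) : Prop :=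
  forall g k : G, K k -> K (k ^ g).

Definition generated (G : groupType) (A : set G) : set G :=
  smallest (@subgroup G) A.

Definition finitely_generated (G : groupType) : Prop :=
  exists2 A : set G, finite_set A & generated A = setT.

Definition torsion_free (G : groupType) : Prop :=
  forall (x : G) (n : nat), (0 < n)%N -> x ^+ n = 1 -> x = 1.

Fixpoint lower_central (G : groupType) (n : nat) {struct n} : set G :=
  if n is n'.+1 then
    generated [set [~ x, y] | x in @lower_central G n' & y in setT]
  else setT.

Definition nilpotent_group (G : groupType) : Prop :=
  exists n : nat, @lower_central G n = [set 1].

Definition right_cosets (G : groupType) (H : set G) : set (set G) :=
  [set [set h * x | h in H] | x in setT].

Definition has_index (G : groupType) (H : set G) (m : nat) : Prop :=
  right_cosets H #= `I_m.

(* This excludes m = 0. *)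
Definition squarefree (m : nat) : Prop :=
  forall d : nat, (d ^ 2 %| m)%N -> d = 1%N.

(* A homomorphism H -> G is encoded as a total function on G of which only the
   values on H matter. *)
Definition homomorphism_on (G : groupType) (H : set G) (f : G -> G) : Prop :=
  {in H &, {morph f : x y / x * y}}.

Definition epimorphism_on (G : groupType) (H : set G) (f : G -> G) : Prop :=
  homomorphism_on H f /\ set_surj H setT f.

Definition simple_on (G : groupType) (H : set G) (f : G -> G) : Prop :=
  forall K : set G, subgroup K -> K `<=` H -> normal_subset K -> f @` K `<=` K ->
  K = [set 1].

(* Main.v *)
(** G permutes the m right cosets of H through a finite nilpotent group; in such
    a group, raising an element to the part of the group order supported on the
    primes of the index of a subgroup brings it into that subgroup.  As m is
    squarefree, |HZ : H| and |G : HZ| are coprime, Z being the center; so there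
    are coprime a and b with y^a in HZ for all y in G and z^b in H for all z in
    Z.

    If G is not abelian, the subgroup B of Z generated by the [x, y], with x in
    the second center Z_2, is nontrivial.  Since [x, y]^(a^2) is a commutator of
    an element of Z_2 \cap H and an element of H, B lies in H (a^2 and b being
    coprime) and f(w)^(a^2) is in B for every w in B.  Hence the set K of central
    elements some a^(2n)-th power of which is in B is a nontrivial normal
    subgroup of G, contained in H and stable under f, contradicting
    simplicity. *)

From mathcomp Require Import all_boot all_fingroup all_solvable.
From mathcomp Require Import boolp classical_sets functions cardinality.
Require Import Defs.

Set Implicit Arguments.
Unset Strict Implicit.
Unset Printing Implicit Defensive.

Local Open Scope group_scope.

(** * Subgroups as sets, and generated subgroups *)

Lemma subgroupP (G : groupType) (H : set G) :
  subgroup H <-> H 1 /\ forall x y, H x -> H y -> H (x * y^-1).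
Proof.
split=> [[H1 HB]|[H1 HB]]; split.
- by rewrite inE in H1.
- by move=> x y Hx Hy; have := HB x y; rewrite !inE; apply.
- by rewrite inE.
- by move=> x y; rewrite !inE; apply: HB.
Qed.

Section Subgroup.
Variables (G : groupType) (H : set G).
Hypothesis sgH : subgroup H.

Lemma subgroup1 : H 1.
Proof. by case/subgroupP: sgH. Qed.

Lemma subgroupV x : H x -> H x^-1.
Proof.
move=> Hx; case/subgroupP: sgH => H1 HB.
by rewrite -(mul1g x^-1); apply: HB.
Qed.

Lemma subgroupM x y : H x -> H y -> H (x * y).
Proof.
move=> Hx /subgroupV Hy; case/subgroupP: sgH => _ HB.
by rewrite -(invgK y); apply: HB.
Qed.

Lemma subgroupX x n : H x -> H (x ^+ n).
Proof.
move=> Hx; elim: n => [|n IHn]; first exact: subgroup1.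
by rewrite expgS; apply: subgroupM.
Qed.

Lemma subgroupR x y : H x -> H y -> H [~ x, y].
Proof.
move=> Hx Hy; have [HVx HVy] := (subgroupV Hx, subgroupV Hy).
by rewrite commgEl /conjg; do !apply: subgroupM => //.
Qed.

(** Bezout: with [u * a = v * b + 1], [x] is the quotient of [x ^+ (a * u)] by [x ^+ (b * v)]. *)
Lemma subgroup_coprime x a b : coprime a b -> H (x ^+ a) -> H (x ^+ b) -> H x.
Proof.
move=> co_ab Ha Hb; case: (posnP a) => [a0|a_gt0].
  by move: co_ab Hb; rewrite a0 /coprime gcd0n => /eqP ->; rewrite expg1.
case: (egcdnP b a_gt0) => u v Duv _; move: Duv; rewrite (eqP co_ab) => Duv.
have ->: x = x ^+ a ^+ u * (x ^+ b ^+ v)^-1.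
  by rewrite -!expgnA mulnC Duv [(b * v)%N]mulnC addn1 expgS mulgK.
by apply: subgroupM; [exact: subgroupX | apply: subgroupV; exact: subgroupX].
Qed.

End Subgroup.

Lemma generated_subgroup (G : groupType) (A : set G) : subgroup (generated A).
Proof.
apply/subgroupP.
split=> [|x y Ax Ay] B /= [/[dup] sgB /subgroupP[B1 BB] sAB] //.
by apply: BB; [apply: Ax | apply: Ay].
Qed.

Lemma sub_generated (G : groupType) (A : set G) x : A x -> generated A x.
Proof. by move=> Ax B /= [_]; apply. Qed.

Lemma generated_min (G : groupType) (A B : set G) :
  subgroup B -> (forall x, A x -> B x) -> forall x, generated A x -> B x.
Proof. by move=> sgB sAB x; apply. Qed.

(** * Central elements and commutator identities *)

Definition central (G : groupType) (z : G) : Prop := forall x, commute z x.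

(** The second center: the elements that are central modulo the center. *)
Definition central2 (G : groupType) (x : G) : Prop :=
  forall y, central [~ x, y].

Lemma central_subgroup (G : groupType) : subgroup (@central G).
Proof.
apply/subgroupP; split=> [x|x y Zx Zy z]; first exact/commute_sym/commute1.
by apply/commute_sym/commuteM; [|apply: commuteV]; apply/commute_sym.
Qed.

(** In general [[~ x1 * x2, y]] is [[~ x1, y] ^ x2 * [~ x2, y]], and conjugation fixes a central
    [[~ x1, y]]. *)
Lemma commMg_central (G : groupType) (x1 x2 y : G) :
  central [~ x1, y] -> [~ x1 * x2, y] = [~ x1, y] * [~ x2, y].
Proof.
move=> Zc; rewrite [LHS]commgEl conjMg invgM -mulgA (mulgA x1^-1).
by rewrite mulgA -(Zc x2^-1) -mulgA.
Qed.

Lemma commXg_central (G : groupType) (x y : G) n :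
  central [~ x, y] -> [~ x ^+ n, y] = [~ x, y] ^+ n.
Proof.
move=> Zc; elim: n => [|n IHn]; first by rewrite comm1g.
by rewrite !expgS commMg_central // IHn.
Qed.

Lemma commgX_central (G : groupType) (x y : G) n :
  central [~ x, y] -> [~ x, y ^+ n] = [~ x, y] ^+ n.
Proof.
move=> Zc; rewrite -invgR commXg_central -invgR.
  by rewrite expVgn invgK.
exact: (subgroupV (central_subgroup G)).
Qed.

Lemma commMzg (G : groupType) (x y z : G) :
  central z -> [~ x * z, y] = [~ x, y].
Proof.
move=> Zz; have zy : z ^ y = z by apply/conjg_fixP/commgP/Zz.
rewrite !commgEl conjMg zy.
by rewrite invgM mulgA -(Zz _) -(mulgA z^-1) mulKVg.
Qed.

Lemma commgMz (G : groupType) (x y z : G) :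
  central z -> [~ x, y * z] = [~ x, y].
Proof. by move=> Zz; rewrite -invgR commMzg // invgR. Qed.

(** If the second center were the center, centrality would climb the lower central series from its
    trivial term up to [G]. *)
Lemma noncentral_central2 (G : groupType) :
  nilpotent_group G -> ~ (forall x : G, central x) ->
  exists2 x : G, central2 x & ~ central x.
Proof.
move=> [n lcn1] nab; apply: contrapT => Z2Z; apply: nab.
have {}Z2Z (x : G) : central2 x -> central x.
  by move=> Z2x; apply: contrapT => nZx; apply: Z2Z; exists x.
suff lcnZ k (x : G) : (k <= n)%N -> lower_central (n - k) x -> central x.
  by move=> x; apply: (lcnZ n) => //; rewrite subnn.
elim: k x => [|k IHk] x le_kn.
  by rewrite subn0 lcn1 => ->; apply: (subgroup1 (central_subgroup G)).
move=> Lx; apply: Z2Z => y; apply: (IHk _ (ltnW le_kn)).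
rewrite -(subnSK le_kn) /=; apply: sub_generated.
by exists x => //; exists y.
Qed.

(** * Powers falling into a subgroup of a finite nilpotent group *)

Section FiniteNilpotent.
Variable gT : finGroupType.
Implicit Types P S C : {group gT}.

(** As [pi] contains the primes of the index, [S] contains the Hall [pi^']-subgroup of [P], which is
    normal by nilpotency and so contains every [pi^']-element, in particular this power of [y]. *)
Lemma expg_index_part P S y : nilpotent P -> S \subset P -> y \in P ->
  y ^+ (#|P|)`_\pi(#|P : S|) \in S.
Proof.
move=> nilP sSP Py; set pi := \pi(_).
have hallS : pi^'.-Hall(P) 'O_pi^'(S).
  rewrite pHallE (fintype.subset_trans (pcore_sub _ _) sSP) /=.
  rewrite (card_Hall (nilpotent_pcore_Hall _ (nilpotentS sSP nilP))).
  rewrite -(Lagrange sSP) partnM ?cardG_gt0 //.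
  rewrite [X in (_ * X)%N]part_p'nat ?muln1 //.
  by rewrite pnatNK pnat_pi.
apply: (fintype.subsetP (pcore_sub pi^' S)).
rewrite (nilpotent_Hall_pcore nilP hallS).
rewrite (mem_Hall_pcore (nilpotent_pcore_Hall _ nilP)) ?groupX //.
rewrite /p_elt; apply: (pnat_dvd _ (part_pnat pi^' #|P|)).
by rewrite order_dvdn -expgM partnC ?cardG_gt0 // -order_dvdn order_dvdG.
Qed.

Lemma squarefree_index_exponents P S C :
  nilpotent P -> S \subset P -> C \subset 'Z(P) ->
  squarefree #|P : S| ->
  exists a b, [/\ coprime a b,
    forall y, y \in P -> y ^+ a \in S * C &
    forall z, z \in C -> z ^+ b \in S].
Proof.
move=> nilP sSP sCZ sqf.
have sCP : C \subset P by apply: fintype.subset_trans (center_sub P).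
have nSC : C \subset 'N(S).
  apply: fintype.subset_trans (cent_sub S).
  apply: fintype.subset_trans (centS sSP).
  by apply: fintype.subset_trans sCZ (finset.subsetIr _ _).
(* [C] centralizes [S], so this join is the product set [S * C]. *)
set T := (S <*> C)%G.
have DT : T :=: S * C by rewrite /T /= norm_joinEr.
have sST : S \subset T by apply: joing_subl.
have sTP : T \subset P by rewrite join_subG sSP.
exists ((#|P|)`_\pi(#|P : T|))%N, ((#|T|)`_\pi(#|T : S|))%N; split.
(* A prime dividing both [#|P : T|] and [#|T : S|] would have its square dividing [#|P : S|]. *)
- apply: (pnat_coprime (part_pnat _ _)).
  apply: (sub_in_pnat _ (part_pnat _ _)) => p _ pTS; apply/negP => pPT.
  have p_pr : prime p by move: pTS; rewrite mem_primes; case/andP.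
  suff /sqf p1 : (p ^ 2 %| #|P : S|)%N by rewrite p1 in p_pr.
  rewrite -(Lagrange_index sTP sST) -mulnn dvdn_mul //.
    by move: pPT; rewrite mem_primes => /and3P[].
  by move: pTS; rewrite mem_primes => /and3P[].
- by move=> y Py; rewrite -DT; apply: expg_index_part.
- move=> z Cz; apply: expg_index_part => //; first exact: nilpotentS nilP.
  by apply: (fintype.subsetP (joing_subr _ _)).
Qed.

End FiniteNilpotent.

(** * The permutation action on right cosets *)

Lemma has_index_cosetP (G : groupType) (H : set G) m :
  subgroup H -> has_index H m ->
  exists2 k : G -> 'I_m, (forall i, exists x, k x = i) &
    forall x y, k x = k y <-> H (x * y^-1).
Proof.
move=> sgH /card_set_bijP[F [Ffun Finj Fsurj]].
pose coset x : set G := [set h * x | h in H]%classic.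
have Rcoset x : right_cosets H (coset x) by exists x.
have ltF x : (F (coset x) < m)%N by apply: Ffun.
exists (fun x => Ordinal (ltF x)).
  move=> i; have [_ [x _ <-] Fx] := Fsurj i (ltn_ord i).
  by exists x; apply: val_inj.
move=> x y; split.
  move=> /(congr1 val) /= eqF.
  have : coset x = coset y by apply: Finj => //; rewrite inE.
  move/(congr1 (fun A : set G => A x)) => eqx.
  have : coset y x.
    by rewrite -eqx; exists 1; [exact: subgroup1 | rewrite mul1g].
  by case=> h Hh <-; rewrite mulgK.
move=> Hxy; apply: val_inj => /=; congr F; apply/seteqP; split=> _ [h Hh <-].
  by exists (h * (x * y^-1)); [exact: subgroupM | rewrite -!mulgA mulVg mulg1].
exists (h * (x * y^-1)^-1); first by apply: subgroupM => //; exact: subgroupV.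
by rewrite invgM invgK -!mulgA mulVg mulg1.
Qed.

(** Right multiplication permutes the right cosets. Permutations compose from left to right, so this
    gives a homomorphism. *)
Lemma coset_perm (G : groupType) (H : set G) m (k : G -> 'I_m) :
  (forall i, exists x, k x = i) -> (forall x y, k x = k y <-> H (x * y^-1)) ->
  exists2 phi : G -> 'S_m, {morph phi : x y / x * y} &
    forall x y, phi y (k x) = k (x * y).
Proof.
move=> ksurj kH; pose c i := projT1 (cid (ksurj i)).
have cK i : k (c i) = i by rewrite /c; case: cid.
have kM x y g : k x = k y -> k (x * g) = k (y * g).
  by move/kH => Hxy; apply/kH; rewrite invgM mulgA mulgK.
pose act g i := k (c i * g).
have actk g x : act g (k x) = k (x * g) by apply: kM; rewrite cK.
have act_inj g : injective (act g).
  apply: (can_inj (g := act g^-1)) => i.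
  by rewrite {2}/act actk mulgK cK.
exists (fun g => perm (act_inj g)) => [x y|x y]; last by rewrite permE actk.
by apply/permP => i; rewrite permM !permE -[i]cK !actk mulgA.
Qed.

(** The kernel of the coset action lies in [H], so membership in [H] can be tested in the finite
    image [P], where [H] becomes the stabilizer of the coset [k 1]. *)
Lemma squarefree_index_central_exponents (G : groupType) (H : set G) m :
  nilpotent_group G -> subgroup H -> has_index H m -> squarefree m ->
  exists a b, [/\ coprime a b,
    forall y : G, exists2 z, central z & H (y ^+ a * z) &
    forall z : G, central z -> H (z ^+ b)].
Proof.
move=> [n lcn1] sgH idxH sqf.
have [k ksurj kH] := has_index_cosetP sgH idxH.
have [phi phiM phik] := coset_perm ksurj kH.
have phi1 : phi 1 = 1 by apply: (mulgI (phi 1)); rewrite -phiM !mulg1.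
have phiV x : phi x^-1 = (phi x)^-1.
  by apply: (mulgI (phi x)); rewrite -phiM !mulgV phi1.
have phiX x j : phi (x ^+ j) = phi x ^+ j.
  by elim: j => // j IHj; rewrite !expgS phiM IHj.
have phiH x : phi x (k 1) = k 1 <-> H x.
  by rewrite phik mul1g kH invg1 mulg1.
pose im (K : set G) : {set 'S_m} :=
  finset (fun p => `[< exists2 g, K g & phi g = p >]).
have imP K p : p \in im K <-> exists2 g, K g & phi g = p.
  by rewrite inE; split=> [/asboolP|?] //; apply/asboolP.
have im_group K : subgroup K -> group_set (im K).
  move=> sgK; apply/group_setP; split.
    by apply/imP; exists 1 => //; exact: subgroup1.
  move=> _ _ /imP[x Kx <-] /imP[y Ky <-]; apply/imP.
  by exists (x * y); [exact: subgroupM | rewrite phiM].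
have sgT : subgroup [set: G]%classic by apply/subgroupP.
pose P := Group (im_group _ sgT).
have phiP x : phi x \in P by apply/imP; exists x.
pose C := Group (im_group _ (central_subgroup G)).
have nilP : nilpotent P.
  apply/lcnP; exists n; apply/trivgP.
  (* The indices are shifted because ['L_1(P)] is [P] while [lower_central 0] is [G]. *)
  have sLim j : 'L_j.+1(P) \subset im (lower_central j).
    elim: j => [|j IHj]; first exact: subxx.
    have gIm := im_group _ (generated_subgroup
      [set [~ x, y] | x in @lower_central G j & y in [set: G]]%classic).
    rewrite lcnSn (gen_subG _ (Group gIm)).
    apply/fintype.subsetP => _ /imset2P[p q Lp Pq ->].
    have /imP[x Lx <-] := fintype.subsetP IHj _ Lp; have /imP[y _ <-] := Pq.
    apply/imP; exists [~ x, y]; last by rewrite !commgEl /conjg !phiM !phiV.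
    by apply: sub_generated; exists x => //; exists y.
  apply: fintype.subset_trans (sLim n) _; apply/fintype.subsetP => p /imP[g].
  by rewrite lcn1 => -> <-; rewrite phi1 set11.
have sCZ : C \subset 'Z(P).
  apply/fintype.subsetP => _ /imP[z Zz <-]; rewrite inE phiP /=.
  by apply/centP => _ /imP[x _ <-]; rewrite /commute -!phiM Zz.
pose S := 'C_P[k 1 | 'P]%G.
have phiS x : phi x \in S <-> H x.
  rewrite inE phiP /= -phiH; split; first by move/astab1P; rewrite /= apermE.
  by move=> fix_x; apply/astab1P; rewrite /= apermE.
(* Orbit-stabilizer: the action is transitive on the [m] cosets. *)
have indexS : #|P : S| = m.
  rewrite -[RHS]card_ord -card_orbit; apply: eq_card => i; rewrite inE.
  have [x <-] := ksurj i; apply/orbitP; exists (phi x) => //.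
  by rewrite /= apermE phik mul1g.
have sSP : S \subset P by apply: finset.subsetIl.
have sqfS : squarefree #|P : S| by rewrite indexS.
have [a [b [co_ab expP expC]]] := squarefree_index_exponents nilP sSP sCZ sqfS.
exists a, b; split=> // [y|z Zz].
  have /mulsgP[s c Ss /imP[z Zz Dc] Dy] := expP _ (phiP y).
  exists z^-1; first exact: (subgroupV (central_subgroup G)).
  by apply/phiS; rewrite phiM phiX phiV Dy -Dc mulgK.
by apply/phiS; rewrite phiX; apply: expC; apply/imP; exists z.
Qed.

(** * Homomorphisms defined on a subgroup *)

Lemma homomorphism_on1 (G : groupType) (H : set G) (f : G -> G) :
  subgroup H -> homomorphism_on H f -> f 1 = 1.
Proof.
move=> sgH fM; have H1 := subgroup1 sgH.
by apply: (mulgI (f 1)); rewrite -fM ?inE // !mulg1.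
Qed.

Lemma homomorphism_onV (G : groupType) (H : set G) (f : G -> G) x :
  subgroup H -> homomorphism_on H f -> H x -> f x^-1 = (f x)^-1.
Proof.
move=> sgH fM Hx; have HV := subgroupV sgH Hx; apply: (mulgI (f x)).
by rewrite -fM ?inE // !mulgV (homomorphism_on1 sgH fM).
Qed.

Lemma homomorphism_onX (G : groupType) (H : set G) (f : G -> G) x n :
  subgroup H -> homomorphism_on H f -> H x -> f (x ^+ n) = f x ^+ n.
Proof.
move=> sgH fM Hx; elim: n => [|n IHn]; first exact: (homomorphism_on1 sgH fM).
by rewrite !expgS fM ?inE ?IHn //; apply: subgroupX.
Qed.

Lemma homomorphism_onR (G : groupType) (H : set G) (f : G -> G) x y :
  subgroup H -> homomorphism_on H f -> H x -> H y -> f [~ x, y] = [~ f x, f y].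
Proof.
move=> sgH fM Hx Hy; rewrite !commgEl /conjg.
have [HVx HVy] := (subgroupV sgH Hx, subgroupV sgH Hy).
have Hxy := subgroupM sgH Hx Hy; have Hxyy := subgroupM sgH HVy Hxy.
by rewrite !fM ?inE // !(homomorphism_onV sgH fM).
Qed.

(** By surjectivity every element of [G] is the image of an element of [H], which commutes with
    [z]. *)
Lemma central_image (G : groupType) (H : set G) (f : G -> G) z :
  epimorphism_on H f -> central z -> H z -> central (f z).
Proof.
move=> [fM fsurj] Zz Hz x; have [y Hy <-] := fsurj x I.
by rewrite /commute -!fM ?inE // Zz.
Qed.

Lemma central2_image (G : groupType) (H : set G) (f : G -> G) x :
  subgroup H -> epimorphism_on H f -> central2 x -> H x -> central2 (f x).
Proof.
move=> sgH epif Z2x Hx y; have [fM fsurj] := epif; have [h Hh <-] := fsurj y I.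
rewrite -(homomorphism_onR sgH fM) //.
by apply: (central_image epif (Z2x h)); apply: subgroupR.
Qed.

Theorem theorem5 (G : groupType) (H : set G) (m : nat) (f : G -> G) :
  finitely_generated G -> torsion_free G -> nilpotent_group G ->
  subgroup H -> has_index H m -> squarefree m ->
  epimorphism_on H f -> simple_on H f ->
  forall x y : G, commute x y.
Proof.
move=> _ _ nilG sgH idxH sqfm epif simplef; have [fM _] := epif.
apply: contrapT => nab.
have [x0 Z2x0 nZx0] := noncentral_central2 nilG nab.
have [a [b [co_ab expa expb]]] :=
  squarefree_index_central_exponents nilG sgH idxH sqfm.
have sgZ := central_subgroup G.
pose B := generated [set [~ x, y] | x in @central2 G & y in [set: G]]%classic.
have sgB : subgroup B by apply: generated_subgroup.
have comB x y : central2 x -> B [~ x, y].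
  by move=> Z2x; apply: sub_generated; exists x => //; exists y.
(* Central factors do not change a commutator, and exponents come out because [[~ x, y]] is
   central. *)
have comX (x y : G) : central2 x -> exists x' y',
    [/\ central2 x', H x', H y' & [~ x, y] ^+ (a * a) = [~ x', y']].
  move=> Z2x; have [z Zz Hxz] := expa x; have [t Zt Hyt] := expa y.
  have Exy u : [~ x ^+ a * z, u] = [~ x, u] ^+ a.
    by rewrite commMzg // commXg_central.
  exists (x ^+ a * z), (y ^+ a * t); split=> // [u|].
    by rewrite Exy; apply: (subgroupX sgZ).
  by rewrite Exy commgMz // commgX_central // expgnA.
have co_aab : coprime (a * a) b by rewrite coprimeMl co_ab.
(* The three properties define a subgroup, so they only need to be checked on the generators of
   [B]. *)
have BZHf : forall w, B w -> [/\ central w, H w & B (f w ^+ (a * a))].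
  apply: generated_min => [|_ [x Z2x [y _ <-]]]; last first.
    have [x' [y' [Z2x' Hx' Hy' Exy]]] := comX x y Z2x.
    have HR : H [~ x', y'] by apply: subgroupR.
    have Hxy : H [~ x, y].
      by apply: (subgroup_coprime sgH co_aab _ (expb _ (Z2x y))); rewrite Exy.
    split=> //; rewrite -(homomorphism_onX _ sgH fM) // Exy.
    rewrite (homomorphism_onR sgH fM) //.
    by apply: comB; apply: central2_image epif _ _.
  apply/subgroupP; split=> [|x y [Zx Hx Bx] [Zy Hy By]].
    split; [exact: (subgroup1 sgZ) | exact: subgroup1 |].
    by rewrite (homomorphism_on1 sgH fM) expg1n; apply: (subgroup1 sgB).
  have [ZVy HVy] := (subgroupV sgZ Zy, subgroupV sgH Hy).
  split; [exact: (subgroupM sgZ) | exact: subgroupM |].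
  rewrite fM ?inE // (homomorphism_onV sgH fM) // expgMn; last first.
    exact: (central_image epif Zx Hx).
  by rewrite expVgn; apply: (subgroupM sgB) => //; apply: (subgroupV sgB).
(* [f] sends [B] only to [a * a]-th roots of elements of [B]; allowing all iterated roots absorbs
   this loss. *)
pose K : set G := fun w => central w /\ exists n, B (w ^+ ((a * a) ^ n)).
have KH w : K w -> H w.
  move=> [Zw [n Bwn]]; have [_ Hwn _] := BZHf _ Bwn.
  by apply: (subgroup_coprime sgH _ Hwn (expb w Zw)); rewrite coprimeXl.
have BK w : B w -> K w.
  by move=> Bw; have [Zw _ _] := BZHf w Bw; split=> //; exists 0%N.
(* A trivial [K] would kill every [[~ x0, y]], making [x0] central. *)
suff K1 : K = [set 1]%classic.
  apply: nZx0 => y; apply/commgP/eqP.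
  by have := BK _ (comB x0 y Z2x0); rewrite K1.
apply: simplef => //.
- apply/subgroupP; split=> [|x y [Zx [i Bx]] [Zy [j By]]].
    by apply: BK; apply: (subgroup1 sgB).
  have ZVy := subgroupV sgZ Zy; split; first exact: (subgroupM sgZ).
  (* A common exponent for both roots. *)
  exists (i + j)%N; rewrite expgMn; last exact: Zx.
  rewrite expVgn expnD {1}expgnA mulnC expgnA.
  by apply: (subgroupM sgB); [|apply: (subgroupV sgB)]; apply: (subgroupX sgB).
- by move=> g w [Zw Bw]; rewrite (_ : w ^ g = w) //; apply/conjg_fixP/commgP/Zw.
- move=> _ [w Kw <-]; have Hw := KH w Kw; have [Zw [n Bwn]] := Kw.
  split; first exact: central_image epif Zw Hw.
  (* Applying [f] costs one more factor [a * a], so [n] becomes [n.+1]. *)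
  have [_ _] := BZHf _ Bwn.
  by rewrite (homomorphism_onX _ sgH fM) // -expgnA -expnSr; exists n.+1.
Qed.
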